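(* Let $\alpha\ge 1$ be an integer and let $F=N(\alpha)$, i.e. $n_F=n\,\alpha^{n-1}$ for $n\ge 1$ and $0_F=0$ (so $1_F=1$). Let $k\ge1$, let $\vec b=\langle b_1,b_2,\dots,b_k\rangle$ be a vector of non-negative integers, and let $n=b_1+b_2+\dots+b_k$. Then the multi $F$-nomial coefficient is equal to the number $c_\alpha(\vec b)$ of labeled $k$-colored $\alpha$-multigraphs $G(\alpha,\vec b)$: $$\binom{n}{b_1,b_2,\dots,b_k}_{F}=c_\alpha(\vec b).$$
   Context: For a sequence $F=\{n_F\}_{n\ge0}$ put $0_F!=1$, $n_F!=n_F\cdot(n-1)_F\cdots 1_F$. For non-negative integers with $b_1+\dots+b_k=n$ the multi $F$-nomial coefficient is $$\binom{n}{b_1,\dots,b_k}_F=\frac{n_F!}{(b_1)_F!\cdots(b_k)_F!}.$$ The sequence $N(\alpha)$ is the sequence of coefficients $n_F=[x^n]\,\frac{x}{(1-\alpha x)^2}$. A labeled $k$-colored $\alpha$-multigraph $G(\alpha,\vec b)$ is a multigraph on the vertex set $\{1,\dots,n\}$ together with a coloring of the vertices by $k$ distinguishable colors $1,\dots,k$ (the coloring is part of the data) such that exactly $b_i$ vertices have color $i$ for each $i$, edges only join vertices of different colors, and any two vertices of different colors are joined by at most $\alpha-1$ (indistinguishable, undirected) edges. $c_\alpha(\vec b)$ denotes the number of these objects. *)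

(* Defs.v *)
From mathcomp Require Import all_boot all_order all_algebra.
From mathcomp Require Import ring.

Set Implicit Arguments.
Unset Strict Implicit.
Unset Printing Implicit Defensive.

Import GRing.Theory.

Definition Ffact (F : nat -> nat) (n : nat) : nat :=
  \prod_(1 <= i < n.+1) F i.

(* A quotient in [rat]: integrality is not built into the definition. *)
Definition Fmultinomial (F : nat -> nat) (k n : nat) (b : 'I_k -> nat) : rat :=
  ((Ffact F n)%:R / (\prod_(i < k) Ffact F (b i))%:R)%R.

Definition Nseq (alpha n : nat) : nat := n * alpha ^ n.-1.

(* [Nseq alpha] is the coefficient sequence of x / (1 - alpha x)^2:
   (1 - alpha x)^2 * (\sum_i Nseq alpha i x^i) = x at every order n < m. *)
Lemma Nseq_gf (alpha m n : nat) : n < m ->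
  (((1 - alpha%:R *: 'X) ^+ 2 * \poly_(i < m) (Nseq alpha i)%:R)`_n
     = ('X : {poly int})`_n)%R.
Proof.
move=> lt_nm; rewrite expr2 -mulrA !mulrBl !mul1r.
rewrite -!scalerAl !(coefB, coefZ, coefXM, coefX, coef_poly) lt_nm /Nseq.
case: n lt_nm => [|[|n]] lt_nm /=.
- by rewrite mul0n !mulr0 !subr0.
- by rewrite (ltnW lt_nm) mul1n mul0n expn0 !mulr0 !subr0.
rewrite (ltnW lt_nm) (ltnW (ltnW lt_nm)).
by case: n lt_nm => [|n] _ /=; rewrite ?expnS; ring.
Qed.

(* A multigraph on n labelled vertices with indistinguishable, undirected edges
   is its symmetric multiplicity function; multiplicities range over 'I_alpha,
   i.e. are at most alpha - 1. *)
Definition is_colored_multigraph (alpha k n : nat) (b : 'I_k -> nat)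
    (col : {ffun 'I_n -> 'I_k}) (mult : {ffun 'I_n * 'I_n -> 'I_alpha}) : bool :=
  [&& [forall i : 'I_k, #|[set v | col v == i]| == b i],
      [forall u : 'I_n, forall v : 'I_n, mult (u, v) == mult (v, u)]
    & [forall u : 'I_n, forall v : 'I_n,
        (col u == col v) ==> (mult (u, v) == 0 :> nat)]].

Definition num_colored_multigraphs (alpha k n : nat) (b : 'I_k -> nat) : nat :=
  #|[set G : {ffun 'I_n -> 'I_k} * {ffun 'I_n * 'I_n -> 'I_alpha}
       | is_colored_multigraph b G.1 G.2]|.

(* Main.v *)
(* Since n_F! = n! * alpha ^ 'C(n, 2), the F-nomial coefficient is the ordinary
   multinomial coefficient times alpha ^ ('C(n, 2) - \sum_i 'C(b_i, 2)).  The
   first factor counts the colorings with class sizes b_i, and the exponent is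
   the number of pairs of vertices of different colors, each of which carries
   one of alpha multiplicities independently. *)
Require Import Defs.
From mathcomp Require Import all_boot all_order all_algebra.
From mathcomp Require Import zify.

Set Implicit Arguments.
Unset Strict Implicit.
Unset Printing Implicit Defensive.

Import GRing.Theory Num.Theory.

Lemma Ffact_Nseq (alpha n : nat) :
  Ffact (Nseq alpha) n = n`! * alpha ^ 'C(n, 2).
Proof.
rewrite /Ffact /Nseq big_split /= fact_prod; congr (_ * _).
by rewrite big_add1 /= -expn_sum bin2_sum.
Qed.

Lemma sum_count_undup (T : eqType) (s : seq T) :
  \sum_(x <- undup s) count_mem x s = size s.
Proof.
rewrite -sum1_size -[RHS]big_undup_iterop_count; apply: eq_bigr => x _.
by rewrite Monoid.iteropE iter_addn addn0 mul1n.
Qed.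

(** Induction on the size, splitting rearrangements by their first entry [x]. Those starting with
    [x] correspond to the rearrangements of [rem x s], whose factorial product lacks exactly one
    factor [count_mem x s]; these factors add up to [size s] over the distinct [x]. *)
Lemma size_permutations_fact (T : finType) (s : seq T) :
  size (permutations s) * \prod_(x : T) (count_mem x s)`! = (size s)`!.
Proof.
have [m] := ubnP (size s); elim: m s => // m IHm s; rewrite ltnS => le_sm.
have [/size0nil->|s_gt0] := posnP (size s).
  by rewrite big1 // => x _; rewrite fact0.
rewrite (perm_size (permutationsE s_gt0)) size_allpairs_dep sumnE big_map.
rewrite -(prednK s_gt0) factS prednK // -[X in _ = X * _]sum_count_undup.
rewrite !big_distrl /=; apply: eq_big_seq => x; rewrite mem_undup => s_x.
have size_rem_s : size (rem x s) = (size s).-1 by rewrite size_rem.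
rewrite -size_rem_s -IHm; last by rewrite size_rem_s; lia.
rewrite mulnCA; congr (_ * _).
rewrite (bigD1 x) // [in RHS](bigD1 x) //= mulnA; congr (_ * _).
  have: 0 < count_mem x s by rewrite -has_count has_pred1.
  by rewrite count_rem s_x /= eqxx subn1; case: (count_mem x s).
by apply: eq_bigr => y /negPf ne_yx; rewrite count_rem /= eq_sym ne_yx andbF subn0.
Qed.

(* A function is listed by its values in the order of its domain; those with
   fibre sizes b are exactly the rearrangements of one fixed list. *)
Lemma card_ffun_fibres (A T : finType) (b : T -> nat) :
  #|A| = \sum_x b x ->
  #|[set f : {ffun A -> T} | [forall x, #|[set a | f a == x]| == b x]]|
    * \prod_x (b x)`! = #|A|`!.
Proof.
move=> cardA; pose s := flatten [seq nseq (b x) x | x <- enum T].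
have count_s x : count_mem x s = b x.
  rewrite count_flatten sumnE 2!big_map big_enum (bigD1 x) //=.
  rewrite count_nseq /= eqxx mul1n big1 ?addn0 // => y /negPf ne_yx.
  by rewrite count_nseq /= ne_yx.
have size_s : size s = #|A|.
  rewrite cardA size_flatten sumnE 2!big_map big_enum.
  by apply: eq_bigr => x _; rewrite size_nseq.
have count_fgraph (f : {ffun A -> T}) x :
    count_mem x (fgraph f) = #|[set a | f a == x]|.
  by rewrite -codom_ffun count_map cardsE cardE size_filter enumT; apply: eq_count.
rewrite -size_s -size_permutations_fact.
rewrite (eq_bigr _ (fun x _ => congr1 factorial (count_s x))).
congr (_ * _); rewrite cardE.
rewrite -(size_map (fun f : {ffun A -> T} => val (fgraph f))).
apply/perm_size/uniq_perm; [|exact: permutations_uniq|].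
  by rewrite map_inj_uniq ?enum_uniq //; apply: inj_comp val_inj (can_inj fgraphK).
move=> t; rewrite mem_permutations; apply/mapP/idP => [[f]|s_t].
  rewrite mem_enum inE => /forallP fb ->; apply/allP => x _ /=.
  by rewrite count_s count_fgraph.
have size_t : size t == #|A| by rewrite (perm_size s_t) size_s.
exists (Finfun (Tuple size_t)); last by rewrite FinfunK.
rewrite mem_enum inE; apply/forallP => x.
by rewrite -count_fgraph FinfunK /= (permP s_t) count_s.
Qed.

(** All [n * n] ordered pairs are counted: the monochromatic ones give the sum of the squared fibre
    sizes, the others are twice the increasing ones. Since m * m = 2 'C(m, 2) + m and the fibre
    sizes add up to [n], the linear terms cancel and the rest is halved. *)
Lemma card_bichromatic_pairs (n : nat) (T : finType) (f : 'I_n -> T) :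
  #|[set p : 'I_n * 'I_n | (p.1 < p.2) && (f p.1 != f p.2)]|
    + \sum_x 'C(#|[set v | f v == x]|, 2) = 'C(n, 2).
Proof.
set E := [set p | _].
have dbl_bin m : 'C(m, 2).*2 + m = m * m.
  by case: m => // m; rewrite bin2 even_halfK /= ?oddM ?oddS ?andNb //; lia.
pose fib x := [set v | f v == x].
have sum_fib : \sum_x #|fib x| = n.
  rewrite -[RHS]card_ord -sum1_card (partition_big f predT) //=.
  by apply: eq_bigr => x _; rewrite sum1_card cardsE.
have card_mono : #|[set p : 'I_n * 'I_n | f p.1 == f p.2]|
    = \sum_x #|fib x| * #|fib x|.
  rewrite -sum1_card (partition_big (fun p => f p.1) predT) //=.
  apply: eq_bigr => x _; rewrite -cardsX -sum1_card; apply: eq_bigl => p.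
  by rewrite !inE; case: (f p.1 =P x) => [->|]; rewrite ?andbF // andbT eq_sym.
have swapK : involutive (@swap_pair 'I_n 'I_n) by case.
(* The bichromatic pairs split into [E] and its disjoint mirror image; no diagonal pair is
   bichromatic. *)
have card_swap : #|[set p : 'I_n * 'I_n | f p.1 != f p.2]| = #|E| + #|E|.
  rewrite -[X in _ + X](card_imset _ (inv_inj swapK)) (can_imset_pre _ swapK).
  rewrite -cardsUI [X in _ + X](_ : _ = 0) ?addn0.
    apply: eq_card => -[u v]; rewrite !inE /= [f v == _]eq_sym.
    by case: ltngtP => [||/val_inj->]; rewrite ?orbF ?eqxx.
  apply/eqP; rewrite cards_eq0; apply/eqP/setP => -[u v]; rewrite !inE /=.
  by case: ltngtP; rewrite ?andbF.
have card_all : #|[set p : 'I_n * 'I_n | f p.1 == f p.2]|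
    + #|[set p : 'I_n * 'I_n | f p.1 != f p.2]| = n * n.
  rewrite -[in RHS](card_ord n) -card_prod -(cardsC [set p | f p.1 == f p.2]).
  by congr (_ + _); apply: eq_card => p; rewrite !inE.
have sum_sq : \sum_x #|fib x| * #|fib x| = (\sum_x 'C(#|fib x|, 2)).*2 + n.
  rewrite -[X in _ = _ + X]sum_fib -muln2 big_distrl -big_split /=.
  by apply: eq_bigr => x _; rewrite muln2 dbl_bin.
rewrite -/(\sum_x 'C(#|fib x|, 2)).
have := dbl_bin n; rewrite -card_all card_mono card_swap sum_sq; lia.
Qed.

(** Such a function is determined by its values on the increasing pairs outside [Z], and these are
    arbitrary: reflexivity of [Z] makes the diagonal vanish. The bound is a successor so that [ord0]
    exists as the default value. *)
Lemma card_sym_ffun (n alpha : nat) (Z : rel 'I_n) :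
  symmetric Z -> reflexive Z ->
  #|[set m : {ffun 'I_n * 'I_n -> 'I_alpha.+1} |
      [forall u, forall v, m (u, v) == m (v, u)]
      && [forall u, forall v, Z u v ==> (m (u, v) == 0 :> nat)]]|
  = alpha.+1 ^ #|[set p : 'I_n * 'I_n | (p.1 < p.2) && ~~ Z p.1 p.2]|.
Proof.
move=> Zsym Zrefl; set E := [set p : 'I_n * 'I_n | _].
(* Symmetric extension from the increasing pairs; on the diagonal it reads [g] itself, which is zero
   there when [g] is supported in [E]. *)
pose sym (g : {ffun 'I_n * 'I_n -> 'I_alpha.+1}) :=
  [ffun p : 'I_n * 'I_n => if p.1 < p.2 then g p else g (p.2, p.1)].
have supp0 (g : {ffun 'I_n * 'I_n -> 'I_alpha.+1}) p :
    g \in pffun_on ord0 [in E] predT -> p \notin E -> g p = ord0.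
  by move=> /pffun_onP[/supportP gE _] /gE.
rewrite -[in RHS](card_ord alpha.+1) -(card_pffun_on ord0 [in E]).
rewrite -[RHS](@card_in_imset _ _ sym); last first.
  move=> g h gE hE /ffunP eq_gh; apply/ffunP => -[u v].
  have := eq_gh (u, v); rewrite !ffunE /=; case: ifP => [//|uv _].
  by rewrite !supp0 // inE /= uv.
apply: eq_card => m; rewrite inE; apply/idP/imsetP => [|[g gE ->]].
  case/andP=> /forallP m_sym /forallP mZ.
  have m0 u v : Z u v -> m (u, v) = ord0.
    by move=> Zuv; apply/val_inj/eqP; have /forallP/(_ v)/implyP := mZ u; apply.
  (* The preimage of [m] under [sym] is its restriction to [E], extended by zero. *)
  exists [ffun p => if p \in E then m p else ord0].
    apply/pffun_onP; split=> //; apply/supportP => p pE.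
    by rewrite ffunE (negPf pE).
  apply/ffunP => -[u v]; rewrite !ffunE !inE /=.
  have msym : m (u, v) = m (v, u) by have /forallP/(_ v)/eqP := m_sym u.
  rewrite [Z v u]Zsym msym; case: ltngtP => [uv|vu|/val_inj->] /=.
  - by case: ifPn => // /negPn /m0; rewrite msym.
  - by case: ifPn => // /negPn /m0; rewrite msym.
  - by rewrite m0.
apply/andP; split; apply/forallP => u; apply/forallP => v; rewrite !ffunE /=.
  by case: ltngtP => // /val_inj->.
apply/implyP=> Zuv.
by case: ifP => _; rewrite supp0 // inE /= ?[Z v u]Zsym Zuv andbF.
Qed.

Theorem corollary2 (alpha k n : nat) (b : 'I_k -> nat)
    (halpha : 1 <= alpha) (hk : 1 <= k) (hn : n = \sum_(i < k) b i) :
  Fmultinomial (Nseq alpha) n b = ((num_colored_multigraphs alpha n b)%:R)%R.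
Proof.
rewrite /Fmultinomial.
have Ffact_gt0 m : 0 < Ffact (Nseq alpha) m.
  by rewrite Ffact_Nseq muln_gt0 fact_gt0 expn_gt0 halpha.
have prod_gt0 : 0 < \prod_(i < k) Ffact (Nseq alpha) (b i).
  by apply: prodn_gt0 => i.
(* Clearing the nonzero denominator leaves an identity between natural numbers. *)
apply: (canLR (mulfK _)); first by rewrite pnatr_eq0 -lt0n.
rewrite -natrM; congr (_%:R)%R.
rewrite (eq_bigr _ (fun i _ => Ffact_Nseq alpha (b i))) big_split /= -expn_sum.
rewrite Ffact_Nseq /num_colored_multigraphs.
pose C := [set f : {ffun 'I_n -> 'I_k} | [forall i, #|[set v | f v == i]| == b i]].
pose wf (f : {ffun 'I_n -> 'I_k}) (m : {ffun 'I_n * 'I_n -> 'I_alpha}) :=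
  [forall u, forall v, m (u, v) == m (v, u)]
    && [forall u, forall v, (f u == f v) ==> (m (u, v) == 0 :> nat)].
(* For a fixed coloring, the power of [alpha] for monochromatic pairs stays on the left, which
   avoids subtraction in the exponent. *)
have card_wf f : f \in C ->
    #|[set m | wf f m]| * alpha ^ (\sum_(i < k) 'C(b i, 2)) = alpha ^ 'C(n, 2).
  rewrite inE => /forallP f_b; rewrite {}/wf.
  case: alpha halpha {Ffact_gt0 prod_gt0} => // a _.
  rewrite (card_sym_ffun _ (Z := fun u v => f u == f v)) //.
  rewrite -expnD -(card_bichromatic_pairs f); congr (_ ^ (_ + _)).
  by apply: eq_bigr => i _; rewrite (eqP (f_b i)).
have cardC : #|C| * \prod_(i < k) (b i)`! = n`!.
  by rewrite card_ffun_fibres card_ord.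
have -> : #|[set G : {ffun 'I_n -> 'I_k} * {ffun 'I_n * 'I_n -> 'I_alpha}
       | is_colored_multigraph b G.1 G.2]| = \sum_(f in C) #|[set m | wf f m]|.
  under [RHS]eq_bigr do rewrite -sum1_card.
  by rewrite pair_big_dep -sum1_card; apply: eq_bigl => G; rewrite !inE.
(* Once the factorials of the [b i] cancel, the identity holds coloring by coloring. *)
rewrite -cardC mulnAC [LHS]mulnC [RHS]mulnCA; congr (_ * _).
rewrite big_distrl -sum1_card big_distrl /=; apply: eq_bigr => f fC.
by rewrite mul1n card_wf.
Qed.
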